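(* Let $T(N)$ denote the number of nodes of the lattice $\Lambda_N$. If $N=2^n$, then as $n\to\infty$, $$\tfrac14(\log_2 N)^2(1+o(1))\;\le\;\log_2 T(N)\;\le\;\tfrac38(\log_2 N)^2(1+o(1)).$$
   Context: An orthogonal array $OA(N, s_1^{k_1} s_2^{k_2}\cdots s_v^{k_v})$ (of strength 2) is an $N\times k$ array, $k=k_1+\cdots+k_v$, whose first $k_1$ columns have entries from $\{0,\dots,s_1-1\}$, next $k_2$ columns entries from $\{0,\dots,s_2-1\}$, etc., such that in every $N\times 2$ subarray every possible ordered pair of symbols occurs equally often as a row. Normally $2\le s_1<s_2<\cdots$ and all $k_i\ge1$; one also allows the trivial array $OA(N,1^1)$, a single column of $N$ zeros. The symbol $(N,s_1^{k_1}s_2^{k_2}\cdots)$ is a parameter set; it is realized if such an array exists. Expansive replacement: given an $OA$ $A$ with $N$ runs and a column of $A$ with $S$ levels, and an orthogonal array $B$ with $S$ runs (possibly the trivial $OA(S,1^1)$), replace that column by the rows of $B$ (symbol $j$ replaced by the $j$-th row of $B$); this includes deleting a factor and replacing an $s$-level factor by an $s'$-level factor when $s'\mid s$. A parameter set $P$ is dominated by $Q$ if an array with parameter set $P$ can be obtained from one with parameter set $Q$ by a finite sequence of expansive replacements. $\Lambda_N$ is the set of realized parameter sets with $N$ runs, partially ordered by dominance (a lattice with maximum $(N,N^1)$ and minimum $(N,1^1)$). *)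

(* Defs.v *)
From HB Require Import structures.
From mathcomp Require Import all_boot all_order all_algebra.
From mathcomp Require Import finmap.
From mathcomp Require Import all_classical all_reals all_analysis.

Set Implicit Arguments.
Unset Strict Implicit.
Unset Printing Implicit Defensive.

Import Order.TTheory GRing.Theory Num.Theory.
Import numFieldNormedType.Exports.

Local Open Scope classical_set_scope.

(* [:: (s_1, k_1); ...; (s_v, k_v)] encodes the symbol s_1^k_1 ... s_v^k_v;
   the number of runs N is kept separate. *)
Definition factors := seq (nat * nat).

Definition proper_factors (p : factors) : bool :=
  [&& p != [::],
      sorted ltn (unzip1 p),
      all (leq 2) (unzip1 p) &
      all (leq 1) (unzip2 p)].

(* The second alternative is the trivial symbol 1^1. *)
Definition parameter_set (p : factors) : bool :=
  proper_factors p || (p == [:: (1, 1)]).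

Definition levels (p : factors) : seq nat :=
  flatten [seq nseq sk.2 sk.1 | sk <- p].

Definition level (p : factors) (j : nat) : nat := nth 0 (levels p) j.

(* The balance of each single column follows from the condition on pairs of
   columns as soon as there are two columns; it is required separately so that
   an array with one column of s levels is also balanced, i.e. s divides N. *)
Definition is_OA (N : nat) (p : factors) (A : 'M[nat]_(N, size (levels p))) :
    Prop :=
  [/\ forall i j, A i j < level p j,
      forall j : 'I_(size (levels p)), exists mu : nat,
        forall a, a < level p j -> #|[pred i | A i j == a]| = mu &
      forall j1 j2 : 'I_(size (levels p)), j1 != j2 -> exists lambda : nat,
        forall a b, a < level p j1 -> b < level p j2 ->
          #|[pred i | (A i j1 == a) && (A i j2 == b)]| = lambda].

Definition realized (N : nat) (p : factors) : Prop :=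
  exists A : 'M[nat]_(N, size (levels p)), is_OA A.

(* The underlying set of the lattice; the dominance order plays no role in the
   number of its nodes. *)
Definition Lambda (N : nat) : set factors :=
  [set p | parameter_set p /\ realized N p].

(* [fset_set] is empty on infinite sets, so a lower bound on T N that is
   positive also asserts that Lambda N is finite. *)
Definition T (N : nat) : nat := #|` fset_set (Lambda N)|.

Definition log2 (R : realType) (x : R) : R := (ln x / ln 2)%R.

(* Main.v *)
Require Import Defs.
From HB Require Import structures.
From mathcomp Require Import all_boot all_order all_algebra all_field.
From mathcomp Require Import finmap.
From mathcomp Require Import all_classical all_reals all_analysis.
From mathcomp Require Import zify ring lra.

Import Order.TTheory GRing.Theory Num.Theory.
Import numFieldNormedType.Exports.

(** Write N = 2^n and m = n/2 (rounded down).

    Upper bound: every level is a power 2^i dividing N, and two distinct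
    columns have levels whose product divides N, so at most one column has more
    than 2^m levels.  If k columns have s levels each, comparing every row with
    a fixed one gives k (s - 1) <= N, hence at most 2^(n+1-i) columns have 2^i
    levels.  Multiplying the numbers of choices for i <= m gives
    log2 (T N) <= 3/8 n^2 + O(n).

    Lower bound: the lines of the affine plane over the field with 2^m elements
    give an array with 2^(2m) runs and 2^m columns of 2^m levels each, and each
    column may be coarsened to any number 2^i of levels, 1 <= i <= m.  Choosing
    the number of columns with 2^i levels freely between 1 and about 2^m / m
    for every i yields 2^(m^2 - O(m log m)) symbols. *)

(** * Row counts in an orthogonal array and the common-point inequality *)

Lemma card_fibers (I : finType) (P : pred I) (f : I -> nat) (s : nat) :
  (forall i, f i < s) ->
  #|P| = \sum_(a < s) #|[pred i | P i && (f i == a)]|.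
Proof.
move=> fs; rewrite -sum1_card
  (partition_big (fun i => Ordinal (fs i)) xpredT) //=.
by apply: eq_bigr => a _; rewrite sum1_card.
Qed.

Lemma column_card {N : nat} {p : factors} {A : 'M[nat]_(N, size (levels p))}
    (oaA : is_OA A) (j : 'I_(size (levels p))) a :
  a < level p j -> level p j * #|[pred i | A i j == a]| = N.
Proof.
case: oaA => Alt A1 _ lta; have [mu muP] := A1 j.
rewrite muP // -[RHS]card_ord.
rewrite (card_fibers _ _ (fun i => A i j) _ (fun i => Alt i j)) /=.
rewrite (eq_bigr (fun=> mu)) ?sum_nat_const ?card_ord // => b _.
exact: muP.
Qed.

Lemma pair_card {N : nat} {p : factors} {A : 'M[nat]_(N, size (levels p))}
    (oaA : is_OA A) (j1 j2 : 'I_(size (levels p))) a b :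
    j1 != j2 -> a < level p j1 -> b < level p j2 ->
  level p j1 * level p j2 * #|[pred i | (A i j1 == a) && (A i j2 == b)]| = N.
Proof.
case: oaA => Alt _ A2 ne12 lta ltb; have [mu muP] := A2 _ _ ne12.
rewrite muP // -[RHS]card_ord.
rewrite (card_fibers _ _ (fun i => A i j1) _ (fun i => Alt i j1)) /=.
rewrite (eq_bigr (fun=> level p j2 * mu)) ?sum_nat_const ?card_ord ?mulnA //.
move=> c _; rewrite (card_fibers _ _ (fun i => A i j2) _ (fun i => Alt i j2)).
rewrite (eq_bigr (fun=> mu)) ?sum_nat_const ?card_ord // => d _.
exact: muP.
Qed.

(* The vectors [s * C j - 1] are pairwise orthogonal over [I], so the sum over
   [i] of [(\sum_(j | D j) (s * C j i - 1)) ^ 2] is [#|D| * (s - 1) * #|I|],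
   while its term at [i0] alone is [(#|D| * (s - 1)) ^ 2]. *)
Lemma common_point_bound (I J : finType) (D : pred J) (C : J -> pred I)
    (s : nat) (i0 : I) :
    (forall j, D j -> C j i0) ->
    (forall j, D j -> s * #|C j| = #|I|) ->
    (forall j j', D j -> D j' -> j != j' ->
       s * s * #|[pred i | C j i && C j' i]| = #|I|) ->
  #|D| * s.-1 <= #|I|.
Proof.
case: s => [|s] Ci0 C1 C2 /=; first by rewrite muln0.
(* From here [s.+1] is the number of levels, so [y i j] is [s] on [C j] and -1 off it. *)
pose y i j : int := (s.+1%:Z * (C j i)%:Z - 1)%R.
have sumC (Q : pred I) : (\sum_i (Q i)%:Z = #|Q|%:Z)%R.
  rewrite -sum1_card -[RHS]natz natr_sum [RHS]big_mkcond /=.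
  by apply: eq_bigr => i _; rewrite unfold_in; case: (Q i).
have yy j j' : D j -> D j' ->
    (\sum_i y i j * y i j' = if j' == j then s%:Z * #|I|%:Z else 0)%R.
  move=> Dj Dj'.
  have -> : (\sum_i y i j * y i j' =
      s.+1%:Z * s.+1%:Z * #|[pred i | C j i && C j' i]|%:Z
      - s.+1%:Z * #|C j|%:Z - s.+1%:Z * #|C j'|%:Z + #|I|%:Z)%R.
    rewrite -!sumC !mulr_sumr -!sumrB -big_split /=.
    apply: eq_bigr => i _; rewrite /y.
    by case: (C j i); case: (C j' i) => /=; ring.
  have e1 : (s.+1%:Z * #|C j|%:Z = #|I|%:Z)%R by rewrite -PoszM C1.
  have e2 : (s.+1%:Z * #|C j'|%:Z = #|I|%:Z)%R by rewrite -PoszM C1.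
  case: eqP => [->|/eqP ne].
    rewrite (_ : #|[pred i | _]| = #|C j|); last first.
      by apply: eq_card => i; rewrite !inE andbb.
    rewrite -mulrA e1 intS; ring.
  rewrite e1 e2 -!PoszM C2 // 1?eq_sym //; ring.
have tot : (\sum_i (\sum_(j | D j) y i j) ^+ 2 = #|D|%:Z * s%:Z * #|I|%:Z)%R.
  under eq_bigr do rewrite expr2 big_distrlr /=.
  rewrite exchange_big /=.
  rewrite (eq_bigr (fun=> s%:Z * #|I|%:Z)%R) => [|j Dj].
    by rewrite sumr_const -mulr_natl natz mulrA.
  rewrite exchange_big /= (bigD1 j) //= yy // eqxx big1 ?addr0 // =>
    j' /andP[Dj' ne].
  by rewrite yy // (negPf ne).
have yi0 : (\sum_(j | D j) y i0 j = #|D|%:Z * s%:Z)%R.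
  rewrite (eq_bigr (fun=> Posz s)) => [|j Dj].
    by rewrite sumr_const -mulr_natl natz.
  rewrite /y Ci0 //=; lia.
have : ((#|D|%:Z * s%:Z) ^+ 2 <= #|D|%:Z * s%:Z * #|I|%:Z)%R.
  rewrite -tot (bigD1 i0) //= yi0 lerDl; apply: sumr_ge0 => i _; exact: sqr_ge0.
rewrite expr2 -!PoszM lez_nat; case: (posnP (#|D| * s)) => [->//|D0].
by rewrite leq_pmul2l.
Qed.

(** * Constraints on the levels and multiplicities of realized symbols *)

Lemma nth_level_mem (p : factors) (j : 'I_(size (levels p))) :
  level p j \in levels p.
Proof. exact: mem_nth. Qed.

Lemma card_level (p : factors) (P : pred nat) :
  #|[pred j : 'I_(size (levels p)) | P (level p j)]| = count P (levels p).
Proof.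
rewrite -sum1_card -sum1_count /= (big_nth 0) big_mkord.
by apply: eq_bigl.
Qed.

Lemma leq_count_levels (p : factors) (P : pred nat) (s k : nat) :
  (s, k) \in p -> P s -> k <= count P (levels p).
Proof.
move=> + Ps; elim: p => // -[s' k'] p IH; rewrite inE /levels /= count_cat.
case/predU1P => [[<- <-]|/IH]; last by move=> /leq_trans; apply;
  rewrite leq_addl.
by rewrite count_nseq Ps mul1n leq_addr.
Qed.

Lemma realized_dvdn N p s k :
  realized N p -> (s, k) \in p -> 0 < k -> 0 < s -> s %| N.
Proof.
case=> A oaA sk k0 s0.
have : 0 < #|[pred j : 'I_(size (levels p)) | level p j == s]|.
  by rewrite (card_level p (pred1 s)); apply: leq_trans k0 _;
    apply: leq_count_levels sk _ => /=.
case/card_gt0P => j /[!inE]/eqP js.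
by have := column_card oaA j 0; rewrite js => /(_ s0) <-; rewrite dvdn_mulr.
Qed.

(** For each column with [s] levels, take the set of rows agreeing there with row [i0]. All these
    sets contain [i0], and balance gives the cardinalities that [common_point_bound] asks for. *)
Lemma realized_rao N p s k :
  0 < N -> realized N p -> (s, k) \in p -> k * s.-1 <= N.
Proof.
move=> N0 [A oaA] sk.
have [Alt _ _] := oaA.
pose i0 : 'I_N := Ordinal N0.
pose D := [pred j : 'I_(size (levels p)) | level p j == s].
have kD : k <= #|D|.
  by rewrite (card_level p (pred1 s)); apply: leq_count_levels sk _ => /=.
apply: leq_trans (leq_mul kD (leqnn _)) _.
rewrite -[leqRHS]card_ord.
apply: (common_point_bound _ _ D (fun j => [pred i | A i j == A i0 j]) s i0)
  => /=.
- by move=> j _.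
- by move=> j /eqP js; rewrite card_ord -[in LHS]js column_card.
- move=> j j' /eqP js /eqP js' ne; rewrite card_ord.
  by rewrite -{1}js -{1}js' pair_card.
Qed.

(** Two such columns would make the positive number [N] a multiple of the product of their levels,
    hence at least [b * b]. *)
Lemma realized_count_large N p b :
  0 < N -> N < b * b -> realized N p -> count (leq b) (levels p) <= 1.
Proof.
move=> N0 Nb [A oaA]; have [Alt _ _] := oaA.
pose i0 : 'I_N := Ordinal N0.
rewrite -card_level; apply/card_le1_eqP => j j' /[!inE] bj bj'.
apply/eqP/negPn/negP => ne.
have := pair_card oaA _ _ _ _ ne (Alt i0 j') (Alt i0 j).
have : b * b <= level p j' * level p j by apply: leq_mul.
case: #|_| => [|k]; first by rewrite muln0; lia.
by rewrite mulnS; lia.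
Qed.

(** * Enumeration of candidate symbols and the upper bound *)

Lemma sorted_levels_filter (P : pred (nat * nat)) (p : factors) :
  sorted ltn (unzip1 p) -> sorted ltn (unzip1 [seq x <- p | P x]).
Proof.
rewrite /unzip1 !sorted_map; apply: sorted_filter => x y z.
exact: ltn_trans.
Qed.

Lemma sorted_split (p : factors) (b : nat) :
  sorted ltn (unzip1 p) ->
  p = [seq x <- p | x.1 < b] ++ [seq x <- p | b <= x.1].
Proof.
elim: p => // x p IH /= pp; have := IH (path_sorted pp).
case: ltnP => [_ {1}-> //|bx] _.
have /allP xp := order_path_min ltn_trans pp.
have bp y : y \in p -> b <= y.1.
  by move=> yp; apply/(leq_trans bx)/ltnW/xp/map_f.
rewrite [in LHS](_ : p = [seq y <- p | b <= y.1]); last first.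
  by symmetry; apply/all_filterP/allP.
rewrite [X in X ++ _](_ : _ = [::]) //.
by apply/eqP; rewrite -[_ == _]negbK -has_filter; apply/hasPn => y /bp;
  rewrite -leqNgt.
Qed.

(** Since [m = m'.+1], the bound [2 ^ (n - m')] is the limit 2^(n+1-i) on the multiplicity of 2^i at
    i = m. The empty tail stands for the absence of that level. *)
Fixpoint small_factors (n m : nat) : seq factors :=
  if m is m'.+1 then
    [seq q ++ t | q <- small_factors n m',
       t <- [::] :: [seq [:: (2 ^ m, k)] | k <- iota 1 (2 ^ (n - m'))]]
  else [:: [::]].

Lemma small_factorsS n m : small_factors n m.+1 =
  [seq q ++ t | q <- small_factors n m,
     t <- [::] :: [seq [:: (2 ^ m.+1, k)] | k <- iota 1 (2 ^ (n - m))]].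
Proof. by []. Qed.

(** Level 2^(m+1) has 1 + 2^(n-m) options, absence included, which is at most 2^(n-m+1). *)
Lemma size_small_factors n m :
  size (small_factors n m) <= 2 ^ (\sum_(i < m) (n - i).+1).
Proof.
elim: m => [|m IH]; first by rewrite big_ord0.
rewrite big_ord_recr small_factorsS size_allpairs /= size_map size_iota expnD
  leq_mul //.
by rewrite expnS mul2n -addnn -add1n leq_add2r expn_gt0.
Qed.

(** Induction on [m], cutting at [2 ^ m.+1]: strict sorting leaves at most one entry at or above the
    cut. *)
Lemma mem_small_factors n m (q : factors) :
    sorted ltn (unzip1 q) ->
    (forall s k, (s, k) \in q -> exists i,
       [/\ 0 < i <= m, s = 2 ^ i & 0 < k <= 2 ^ (n.+1 - i)]) ->
  q \in small_factors n m.
Proof.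
elim: m q => [|m IH] q sq qP.
  case: q sq qP => [//|[s k] q] _ /(_ s k); rewrite mem_head => /(_ isT) [i []].
  by case: i.
rewrite (sorted_split q (2 ^ m.+1) sq) small_factorsS; apply/allpairsP.
exists ([seq x <- q | x.1 < 2 ^ m.+1], [seq x <- q | 2 ^ m.+1 <= x.1]);
  split=> //=.
  apply: IH => [|s k].
    exact: sorted_levels_filter.
  rewrite mem_filter /= => /andP[lts /qP[i [/andP[i0 im] si kP]]].
  exists i; split=> //; rewrite i0 /=.
  by move: lts; rewrite si ltn_exp2l // ltnS.
set t := seq.filter _ q.
have st : sorted ltn (unzip1 t).
  exact: sorted_levels_filter.
have tP s k : (s, k) \in t -> s = 2 ^ m.+1 /\ 0 < k <= 2 ^ (n - m).
  rewrite mem_filter /= => /andP[les /qP[i [/andP[i0 im] si kP]]].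
  have -> : m = i.-1.
    by move: les; rewrite si leq_exp2l //; lia.
  by rewrite prednK // si; split=> //; rewrite (_ : n - i.-1 = n.+1 - i) //;
    lia.
case: t st tP => [|[s k] [|[s' k'] t]] /= st tP.
- by rewrite mem_head.
- have [-> kP] := tP s k (mem_head _ _).
  rewrite inE /=; apply/mapP; exists k => //.
  by rewrite mem_iota; lia.
- have [es _] := tP s k (mem_head _ _).
  have [es' _] : s' = 2 ^ m.+1 /\ 0 < k' <= 2 ^ (n - m).
    by apply: tP; rewrite !inE eqxx orbT.
  by move: st; rewrite es es' ltnn.
Qed.

(** The tail is the possible single column with more than 2^(n/2) levels. Letting [j] run over all
    exponents also produces unsorted lists, which is harmless for an upper bound. *)
Definition proper_candidates (n : nat) : seq factors :=
  [seq q ++ t | q <- small_factors n n./2,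
     t <- [::] :: [seq [:: (2 ^ j, 1)] | j <- iota 1 n]].

(** The successor leaves room for the trivial symbol 1^1. *)
Lemma size_proper_candidates n :
  (size (proper_candidates n)).+1 <= 2 ^ (\sum_(i < n./2) (n - i).+1 + n.+1).
Proof.
rewrite size_allpairs /= size_map size_iota.
have := size_small_factors n n./2.
set a := size _; set E := (\sum_(i < _) _) => aE.
have E0 : 0 < 2 ^ E by rewrite expn_gt0.
have n2 : n.+1 < 2 ^ n.+1 by exact: ltn_expl.
rewrite expnD; nia.
Qed.

Lemma Lambda_candidates n (p : factors) :
  Lambda (2 ^ n) p -> p \in [:: (1, 1)] :: proper_candidates n.
Proof.
case=> pp rp; case/orP: pp => [/and4P[_ sp lev mult]|/eqP->];
  last by rewrite mem_head.
have N0 : 0 < 2 ^ n by rewrite expn_gt0.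
have pP s k : (s, k) \in p -> exists i,
    [/\ 0 < i <= n, s = 2 ^ i & 0 < k <= 2 ^ (n.+1 - i)].
  move=> sk.
  have s2 : 1 < s by have /allP := lev; apply; apply/mapP; exists (s, k).
  have k1 : 0 < k by have /allP := mult; apply; apply/mapP; exists (s, k).
  have /(dvdn_pfactor _ _ (isT : prime 2))[i lein si] :=
    realized_dvdn _ _ _ _ rp sk k1 (ltnW s2).
  exists i; split=> //; first by rewrite lein andbT; move: s2; rewrite si;
    case: (i).
  (* As 2^i <= 2 (2^i - 1) for i >= 1, the bound k (2^i - 1) <= 2^n gives k 2^i <= 2^(n+1). *)
  rewrite k1 /=; have := realized_rao _ _ _ _ N0 rp sk => ks.
  rewrite -(leq_pmul2r (expn_gt0 2 i : 0 < 2 ^ i)) -expnD subnK; last lia.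
  rewrite -si expnS; nia.
rewrite inE; apply/orP; right.
have Nb : 2 ^ n < 2 ^ n./2.+1 * 2 ^ n./2.+1 by rewrite -expnD ltn_exp2l //; lia.
have large := realized_count_large _ _ _ N0 Nb rp.
apply/allpairsP.
exists ([seq x <- p | x.1 < 2 ^ n./2.+1], [seq x <- p | 2 ^ n./2.+1 <= x.1]).
split; last exact: sorted_split.
  apply: mem_small_factors => [|s k] /=.
    exact: sorted_levels_filter.
  rewrite mem_filter /= => /andP[lts /pP[i [/andP[i0 im] si kP]]].
  by exists i; split=> //; rewrite i0 /=; move: lts; rewrite si ltn_exp2l.
rewrite /=; set t := seq.filter _ p.
have tP s k : (s, k) \in t -> [/\ (s, k) \in p & 2 ^ n./2.+1 <= s].
  by rewrite mem_filter => /andP[? ?].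
have ct : count (leq (2 ^ n./2.+1)) (levels t) <= 1.
  apply: leq_trans large; rewrite /t /levels; elim: (p) => //= -[s k] q IH.
  case: ifP => _; rewrite /= !count_cat ?leq_add2l //.
  exact: leq_trans IH (leq_addl _ _).
(* A second entry, or a multiplicity above 1, would give two large columns. *)
case: t tP ct => [|[s k] t] tP ct; first by rewrite mem_head.
have [skp les] := tP s k (mem_head _ _).
have [i [iP si /andP[k0 _]]] := pP s k skp.
case: t tP ct => [|[s' k'] t] tP.
  rewrite /levels /= cats0 count_nseq les mul1n => k1.
  have -> : k = 1 by lia.
  by rewrite inE; apply/orP; right; apply/mapP; exists i;
    rewrite ?si // mem_iota; lia.
have [|skp' les'] := tP s' k'; first by rewrite !inE eqxx orbT.
have [i' [_ _ /andP[k0' _]]] := pP s' k' skp'.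
by rewrite /levels /= !count_cat !count_nseq les les'; lia.
Qed.

Lemma Lambda_finite n : finite_set (Lambda (2 ^ n)).
Proof.
apply: (sub_finite_set (B :=
  [set` [:: (1, 1)] :: proper_candidates n])%classic); last exact: finite_seq.
by move=> p /Lambda_candidates.
Qed.

Lemma T_upper n : T (2 ^ n) <= 2 ^ (\sum_(i < n./2) (n - i).+1 + n.+1).
Proof.
apply: leq_trans (size_proper_candidates n); rewrite /T.
apply: (@uniq_leq_size _ _ ([:: (1, 1)] :: proper_candidates n)).
  exact: fset_uniq.
move=> p; rewrite in_fset_set; last exact: Lambda_finite.
by rewrite inE; exact: Lambda_candidates.
Qed.

(** * Arrays over finite fields and the lower bound *)

Lemma balanced_map_exists (I : finType) (s : nat) : s %| #|I| ->
  exists f : I -> nat, (forall x, f x < s) /\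
    forall a, a < s -> #|[pred x | f x == a]| = #|I| %/ s.
Proof.
move=> /dvdnP[t It].
(* Through a bijection of [I] with ['I_s * 'I_t], the first coordinate is a map whose fibers all
   have [t] elements. *)
have cI : #|I| = #|{: 'I_s * 'I_t}| by rewrite card_prod !card_ord mulnC.
pose g (x : I) : 'I_s * 'I_t := enum_val (cast_ord cI (enum_rank x)).
have gK : cancel g (fun z => enum_val (cast_ord (esym cI) (enum_rank z))).
  by move=> x; rewrite /g enum_valK cast_ordK enum_rankK.
have gK' : cancel (fun z => enum_val (cast_ord (esym cI) (enum_rank z))) g.
  by move=> z; rewrite /g enum_valK cast_ordKV enum_rankK.
exists (fun x => (g x).1); split=> [x|a sa]; first exact: ltn_ord.
have s0 : 0 < s by apply: leq_trans sa.
rewrite It mulnK //.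
have -> : #|[pred x | (g x).1 == a :> nat]| =
  #|[pred z : 'I_s * 'I_t | z.1 == a :> nat]|.
  rewrite -(fintype.card_image (can_inj gK)); apply: eq_card => z; rewrite !inE.
  apply/fintype.imageP/idP => [[x /[!inE] xa ->] //|za].
  by exists (enum_val (cast_ord (esym cI) (enum_rank z))); rewrite ?inE gK'.
rewrite (_ : #|_| = #|[predX pred1 (Ordinal sa) & 'I_t]|).
  by rewrite cardX card1 mul1n card_ord.
by apply: eq_card => z; rewrite !inE andbT -val_eqE.
Qed.

(** Lets rows be indexed by any finite type, such as triples over a field; enumerating [X]
    transports the counts. *)
Lemma realized_of_rows (X : finType) (p : factors)
    (f : X -> 'I_(size (levels p)) -> nat) :
    (forall x j, f x j < level p j) ->
    (forall j : 'I_(size (levels p)), exists mu : nat,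
       forall a, a < level p j ->
       #|[pred x | f x j == a]| = mu) ->
    (forall j1 j2 : 'I_(size (levels p)), j1 != j2 -> exists lambda : nat,
       forall a b,
       a < level p j1 -> b < level p j2 ->
       #|[pred x | (f x j1 == a) && (f x j2 == b)]| = lambda) ->
  realized #|X| p.
Proof.
move=> f0 f1 f2.
have cardE (P : pred X) : #|[pred i : 'I_#|X| | P (enum_val i)]| = #|P|.
  rewrite -(fintype.card_image enum_val_inj); apply: eq_card => x.
  apply/fintype.imageP/idP => [[i /[!inE] Pi ->] //|Px].
  by exists (enum_rank x); rewrite ?inE enum_rankK.
exists (\matrix_(i, j) f (enum_val i) j)%R; split.
- by move=> i j; rewrite mxE.
- move=> j; have [mu muP] := f1 j; exists mu => a /muP <-.
  by rewrite -[RHS]cardE; apply: eq_card => i; rewrite !inE mxE.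
- move=> j1 j2 /f2[mu muP]; exists mu => a b lta ltb; rewrite -(muP a b) //.
  by rewrite -[RHS]cardE; apply: eq_card => i; rewrite !inE !mxE.
Qed.

(* Rows are indexed by pairs [(x, y)] in the field, columns by distinct slopes
   [c], with entry [x + c * y]; the unused coordinate in ['I_d] repeats each
   row [d] times. *)
Lemma realized_field (F : finFieldType) (d : nat) (p : factors) :
    size (levels p) <= #|F| -> all (dvdn^~ #|F|) (levels p) ->
  realized (#|F| * #|F| * d) p.
Proof.
move=> szp /allP dvdp.
pose c (j : 'I_(size (levels p))) : F := enum_val (widen_ord szp j).
have c_inj : injective c by move=> j j' /enum_val_inj/(congr1 val)/= /val_inj.
have /choice[h hP] (j : 'I_(size (levels p))) : exists f : F -> nat,
    (forall x, f x < level p j) /\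
    forall a, a < level p j -> #|[pred x | f x == a]| = #|F| %/ level p j.
  exact/balanced_map_exists/dvdp/nth_level_mem.
have -> : #|F| * #|F| * d = #|{: F * F * 'I_d}| by rewrite !card_prod card_ord.
(* An injective [g] permutes the plane, so the count becomes that of a product set, times the [d]
   repetitions. *)
have pairE (P Q : pred F) (g : F * F -> F * F) : injective g ->
    #|[pred x : F * F * 'I_d | P (g x.1).1 && Q (g x.1).2]| = #|P| * #|Q| * d.
  move=> g_inj; rewrite -[X in _ = _ * X]card_ord -!cardX.
  have gd_inj : injective (fun x : F * F * 'I_d => (g x.1, x.2)).
    by move=> [x i] [x' i'] /= [/g_inj-> ->].
  rewrite -(fintype.card_image gd_inj); apply: eq_card => z; rewrite !inE andbT.
  have [g' gK g'K] := injF_bij g_inj.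
  apply/fintype.imageP/idP => [[x /[!inE] ? ->] //|Pz].
  by exists (g' z.1, z.2); rewrite ?inE /= ?g'K //; case: (z).
pose f (x : F * F * 'I_d) j := h j (x.1.1 + c j * x.1.2)%R.
apply: (realized_of_rows _ _ f) => [x j|j|j1 j2 ne].
- exact: (hP j).1.
- exists ((#|F| %/ level p j) * #|F| * d) => a /(hP j).2 <-.
  rewrite -(pairE _ _ (fun x => (x.1 + c j * x.2, x.2)%R)).
    by apply: eq_card => x; rewrite !inE andbT.
  by move=> [x y] [x' y'] /= [/[swap] ->] /addIr ->.
- exists ((#|F| %/ level p j1) * (#|F| %/ level p j2) * d) => a b lta ltb.
  rewrite -((hP j1).2 a lta) -((hP j2).2 b ltb).
  rewrite -(pairE _ _ (fun x => (x.1 + c j1 * x.2, x.1 + c j2 * x.2)%R)) //.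
  move=> [x y] [x' y'] /= [e1 e2].
  (* Subtracting the two equations eliminates the first coordinate, and distinct slopes then force
     [y = y']. *)
  have : ((c j1 - c j2) * (y - y') = 0)%R.
    have -> : ((c j1 - c j2) * (y - y') = (x + c j1 * y) - (x' + c j1 * y')
      - ((x + c j2 * y) - (x' + c j2 * y')))%R by ring.
    by rewrite e1 e2 !subrr.
  move/eqP; rewrite mulf_eq0 !subr_eq0 (inj_eq c_inj) (negPf ne) /= => /eqP ey.
  by move: e1; rewrite ey => /addIr ->.
Qed.

(** The successors make every exponent from 1 to [m] occur, with multiplicity between 1 and [b], so
    that [c] can be read off the symbol. *)
Definition power_factors (m b : nat) (c : {ffun 'I_m -> 'I_b}) : factors :=
  [seq (2 ^ (i : 'I_m).+1, (c i).+1) | i <- enum 'I_m].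

Lemma power_factors_inj m b : injective (@power_factors m b).
Proof.
move=> c c' /eq_in_map e; apply/ffunP => i.
by have [] := e i (mem_enum _ _) => /val_inj.
Qed.

Lemma size_power_factors m b (c : {ffun 'I_m -> 'I_b}) :
  size (levels (power_factors m b c)) <= m * b.
Proof.
rewrite /levels /power_factors size_flatten sumnE /shape 3!big_map.
apply: (@leq_trans (\sum_(i <- enum 'I_m) b)).
  by apply: leq_sum => i _; rewrite size_nseq /=; exact: ltn_ord.
by rewrite big_const_seq count_predT size_enum_ord iter_addn_0 mulnC.
Qed.

Lemma power_factors_Lambda m b d (c : {ffun 'I_m -> 'I_b}) :
  0 < m -> m * b <= 2 ^ m -> Lambda (2 ^ m * 2 ^ m * d) (power_factors m b c).
Proof.
move=> m0 mb; split.
  apply/orP; left; rewrite /proper_factors; apply/and4P; split.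
  - by rewrite -size_eq0 size_map size_enum_ord -lt0n.
  - rewrite /unzip1 -map_comp (map_comp (fun i => 2 ^ i.+1) val) val_enum_ord.
    rewrite sorted_map; apply: sub_sorted (iota_ltn_sorted 0 m) => i j ij /=.
    by rewrite ltn_exp2l.
  - by apply/allP => s /mapP[_ /mapP[i _ ->] ->] /=;
      rewrite expnS leq_pmulr // expn_gt0.
  - by apply/allP => s /mapP[_ /mapP[i _ ->] ->].
have [F _ cF] := pPrimePowerField (isT : prime 2) m0.
rewrite -cF; apply: realized_field; rewrite cF.
  exact: leq_trans (size_power_factors m b c) mb.
apply/allP => s /flatten_mapP[_ /mapP[i _ ->]];
  rewrite mem_nseq => /andP[_ /eqP ->] /=.
exact: dvdn_exp2l.
Qed.

Lemma T_lower n m b :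
  0 < m -> m.*2 <= n -> m * b <= 2 ^ m -> b ^ m <= T (2 ^ n).
Proof.
move=> m0 mn mb.
(* The surplus factor [2 ^ (n - m.*2)] becomes the number [d] of repetitions of each row. *)
have nE : 2 ^ n = 2 ^ m * 2 ^ m * 2 ^ (n - m.*2).
  by rewrite -!expnD addnn subnKC.
rewrite -[b ^ m](_ : #|{ffun 'I_m -> 'I_b}| = _);
  last by rewrite card_ffun !card_ord.
rewrite cardE -(size_map (@power_factors m b)) /T.
apply: uniq_leq_size; first by rewrite map_inj_uniq ?enum_uniq //;
  exact: power_factors_inj.
move=> _ /mapP[c _ ->]; rewrite in_fset_set; last exact: Lambda_finite.
by rewrite inE nE; apply: power_factors_Lambda.
Qed.

(** * Estimates of the exponents and the asymptotic statement *)

Lemma sqr_up_log2 n : up_log 2 n ^ 2 <= 4 * n.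
Proof.
(* If [up_log 2 n = l.+1] then 2^l < n, so this inequality suffices. *)
have sqr_exp l : l.+1 ^ 2 <= 4 * 2 ^ l.
  by elim: l => [//|[//|[//|l]] IH]; rewrite (expnS 2); nia.
case: (ltnP 1 n) => [n1|]; last by case: n => [|[|]].
have := up_log_gtn (isT : 1 < 2) n1.
have : 0 < up_log 2 n by rewrite up_log_gt0.
by case: (up_log 2 n) => // l _ /= ln; apply: leq_trans (sqr_exp l) _; lia.
Qed.

(** Takes [b = 2 ^ (m - up_log 2 m)] in [T_lower]; [m * b <= 2 ^ m] because m is at most
    [2 ^ up_log 2 m]. *)
Lemma T_lower_exp n : 1 < n ->
  2 ^ ((n./2 - up_log 2 n./2) * n./2) <= T (2 ^ n).
Proof.
move=> n1; set m := n./2; have mP : 0 < m by rewrite half_gt0.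
have lm : up_log 2 m <= m by apply: up_log_min => //; apply/ltnW/ltn_expl.
rewrite expnM; apply: T_lower => //; first by rewrite /m; lia.
rewrite -[X in _ <= 2 ^ X](subnKC lm) expnD leq_mul2r; apply/orP; right;
  exact: up_logP.
Qed.

Lemma sum_upper_exponents n :
  8 * \sum_(i < n./2) (n - i).+1 <= 3 * n ^ 2 + 6 * n.
Proof.
have sumE m : m <= n -> 2 * \sum_(i < m) (n - i).+1 + m * m = m * (2 * n + 3).
  elim: m => [|m IH] mn; first by rewrite big_ord0.
  rewrite big_ord_recr /= mulnDr; move: (IH (ltnW mn));
    move: (\sum_(i < m) _) => S.
  have [k ->] : exists k, n = m + k by exists (n - m); lia.
  by rewrite addKn; nia.
have : n./2 <= n by lia.
move/sumE; set S := \sum_(i < _) _ => eS.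
have : n./2.*2 <= n by lia.
move: (n./2) eS => m eS mn;
have [k nE] : exists k, n = m.*2 + k by exists (n - m.*2); lia.
by move: eS; rewrite {}nE -muln2; nia.
Qed.

Lemma log2_natX (R : realType) k : log2 ((2 ^ k)%:R : R)%R = (k%:R)%R.
Proof.
have ln2 : (ln 2 != 0 :> R)%R by rewrite gt_eqF // ln_gt0 // ltr1n.
by rewrite /log2 natrX lnXn // -[X in (X / _)%R]mulr_natl mulfK.
Qed.

Lemma ler_log2 (R : realType) (a b : nat) :
  0 < a -> a <= b -> (log2 (a%:R : R) <= log2 (b%:R : R))%R.
Proof.
move=> a0 ab; rewrite /log2 ler_pM2r ?invr_gt0 ?ln_gt0 ?ltr1n //.
by rewrite ler_ln ?posrE ?ltr0n ?ler_nat // (leq_trans a0).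
Qed.

Local Open Scope classical_set_scope.
Local Open Scope ring_scope.

Theorem theorem2 (R : realType) :
  exists e1 e2 : nat -> R,
    [/\ e1 n @[n --> \oo] --> (0 : R),
        e2 n @[n --> \oo] --> (0 : R) &
        \forall n \near \oo, forall N : nat, N = (2 ^ n)%N ->
          4^-1 * log2 (N%:R : R) ^+ 2 * (1 + e1 n)
            <= log2 ((T N)%:R : R)
            <= 3 / 8 * log2 (N%:R : R) ^+ 2 * (1 + e2 n)].
Proof.
(* Here [harmonic n] is 1/(n+1). The lower exponent loses O(n^(3/2)) through [up_log], of relative
   order n^(-1/2); the upper one exceeds its main term by O(n), of relative order 1/n. The factor 16
   is generous. *)
exists (fun n => - 16 * Num.sqrt (harmonic n)), (fun n => 16 * harmonic n);
  split.
- rewrite -[X in _ --> X](mulr0 (- 16)); apply: cvgMr.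
  rewrite -[X in _ --> X]sqrtr0.
  exact: (continuous_cvg _ (@sqrt_continuous R 0) cvg_harmonic).
- by rewrite -[X in _ --> X](mulr0 16); apply: cvgMr; exact: cvg_harmonic.
near=> n => N ->.
have n1 : (1 < n)%N by near: n; exists 2%N.
rewrite log2_natX; apply/andP; split.
  have /(ler_log2 R) : (0 < 2 ^ ((n./2 - up_log 2 n./2) * n./2))%N
    by rewrite expn_gt0.
  move=> /(_ _ (T_lower_exp n n1)); apply: le_trans; rewrite log2_natX.
  have lm : (up_log 2 n./2 <= n./2)%N by apply: up_log_min => //;
    apply/ltnW/ltn_expl.
  have l2 := sqr_up_log2 n./2.
  rewrite natrM natrB //.
  rewrite /harmonic /= sqrtrV ?ler0n //; set v := Num.sqrt _.
  have v2 : v ^+ 2 = n%:R + 1 by rewrite sqr_sqrtr ?ler0n // -natr1.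
  have m1 : (n./2)%:R * 2 <= n%:R :> R by rewrite -natrM ler_nat; lia.
  have m2 : n%:R <= (n./2)%:R * 2 + 1 :> R by rewrite -natrM natr1 ler_nat; lia.
  have {}l2 : (up_log 2 n./2)%:R ^+ 2 <= 4 * (n./2)%:R :> R.
    by rewrite -natrX -natrM ler_nat.
  have x1 : 1 <= n%:R :> R by rewrite ler1n ltnW.
  have l0 : 0 <= (up_log 2 n./2)%:R :> R by [].
  have v0 : 0 <= v by exact: sqrtr_ge0.
  move: (n%:R) ((n./2)%:R) ((up_log 2 n./2)%:R) v2 m1 m2 l2 x1 l0 =>
    x m l v2 m1 m2 l2 x1 l0.
  (* The loss [m * l] is at most [x * v], while the allowance [4 * (x ^+ 2 / v)] is at least
     [2 * x * v]; the rest covers the rounding in [m]. *)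
  have v1 : 1 <= v by nra.
  have lv : l <= 2 * v by nra.
  have mlv : m * l <= x * v by nra.
  have xv : x * v / 2 <= x ^+ 2 / v.
    by rewrite ler_pdivlMr; nra.
  rewrite [leLHS](_ : _ = x ^+ 2 / 4 - 4 * (x ^+ 2 / v)); last by field; lra.
  nra.
have T0 : (0 < T (2 ^ n))%N by apply: leq_trans (T_lower_exp n n1);
  rewrite expn_gt0.
apply: le_trans (ler_log2 R _ _ T0 (T_upper n)) _; rewrite log2_natX.
have := sum_upper_exponents n; rewrite -mulnn -(ler_nat R) natrD !natrM.
rewrite natrD /harmonic /= -[n.+1%:R]natr1.
have x1 : 1 <= n%:R :> R by rewrite ler1n ltnW.
move: x1; move: (n%:R) ((\sum_(i < _) _)%N%:R) => x S x1 Sx.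
(* The error term contributes 6 x^2/(x+1) >= 3x, which absorbs the linear excess 7x/4 + 1. *)
have hx : x / 2 <= x ^+ 2 / (x + 1) by rewrite ler_pdivlMr; nra.
rewrite [leRHS](_ : _ = 3 / 8 * x ^+ 2 + 6 * (x ^+ 2 / (x + 1))); last by field;
  lra.
lra.
Unshelve. all: by end_near.
Qed.
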